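(* Let $\mathbf{b}\in\mathbb{R}^d$ be constant, let $c:\Omega\to\mathbb{R}$ be bounded and nonnegative with $c_0=\inf_\Omega c$, let $f$ be bounded on $\Omega$ and $g$ continuous on $\partial\Omega$, and let $\epsilon,\sigma,\gamma\ge0$ and $p\in[0,1]$ be constants. Suppose $\epsilon>0$ or $c_0>0$, and suppose $u\in C^5(\overline{\Omega})$ is the solution of $$-\epsilon\Delta u+\mathbf{b}\cdot\nabla u+cu=f\ \text{ in }\Omega,\qquad u=g\ \text{ on }\partial\Omega.$$ For each mesh $\mathbf{h}$ let $U$ be the solution of the finite difference scheme $$\widehat{L}^\epsilon_{\mathbf{h}}[U_\alpha]=f(\mathbf{x}_\alpha)\ \text{ if }\mathbf{x}_\alpha\in\mathcal{T}_{\mathbf{h}}\cap\Omega,\qquad U_\alpha=g(\mathbf{x}_\alpha)\ \text{ if }\mathbf{x}_\alpha\in\mathcal{T}_{\mathbf{h}}\cap\partial\Omega,$$ $$-\delta^2_{x_i,h_i}U_\alpha=0\ \text{ if }\mathbf{x}_\alpha\in\mathcal{S}_{h_i},\ i=1,\dots,d.$$ Then $$\Big(\prod_{i=1}^d h_i^{1/2}\Big)\|U-u\|_{\ell^2(\mathcal{T}_{\mathbf{h}}\cap\Omega)}\le C\,h^{p+\frac12}$$ for some constant $C$ independent of $\mathbf{h}$.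
   Context: Domain and mesh: $\Omega=(a_1,b_1)\times\cdots\times(a_d,b_d)\subset\mathbb{R}^d$. For integers $J_i\ge 3$ set $h_i=(b_i-a_i)/(J_i-1)$, $\mathbf{h}=(h_1,\dots,h_d)$, $h=\max_i h_i$. The grid is $\mathcal{T}_{\mathbf{h}}=\{\mathbf{x}_\alpha\}$ with $\mathbf{x}_\alpha=(a_1+(\alpha_1-1)h_1,\dots,a_d+(\alpha_d-1)h_d)$, $1\le\alpha_i\le J_i$. Let $\mathbf{e}_i$ be the canonical basis vectors. Boundary nodes and ghost points: $\mathcal{S}_{h_i}$ is the set of $\mathbf{x}_\alpha\in\mathcal{T}_{\mathbf{h}}\cap\partial\Omega$ such that $\mathbf{x}_\alpha+h_i\mathbf{e}_i\in\mathcal{T}_{\mathbf{h}}\cap\Omega$ or $\mathbf{x}_\alpha-h_i\mathbf{e}_i\in\mathcal{T}_{\mathbf{h}}\cap\Omega$. For each $\mathbf{x}_\alpha\in\mathcal{S}_{h_i}$ the one of $\mathbf{x}_\alpha\pm h_i\mathbf{e}_i$ lying outside $\overline{\Omega}$ is a ghost point; grid functions $U$ are defined on $\mathcal{T}_{\mathbf{h}}$ together with the ghost points. Difference operators: $\delta_{x_i,h_i}U_\alpha=\frac{U_{\alpha+\mathbf{e}_i}-U_{\alpha-\mathbf{e}_i}}{2h_i}$, $\nabla_{\mathbf{h}}=[\delta_{x_1,h_1},\dots,\delta_{x_d,h_d}]^T$, $\delta^2_{x_i,h_i}U_\alpha=\frac{U_{\alpha+\mathbf{e}_i}-2U_\alpha+U_{\alpha-\mathbf{e}_i}}{h_i^2}$,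 $\delta^2_{x_i,2h_i}U_\alpha=\frac{U_{\alpha+2\mathbf{e}_i}-2U_\alpha+U_{\alpha-2\mathbf{e}_i}}{4h_i^2}$, $\Delta_{\mathbf{h}}=\sum_{i=1}^d\delta^2_{x_i,h_i}$. Numerical moment: $M^p_{\mathbf{h}}U_\alpha=\sum_{i=1}^d h_i^p(\delta^2_{x_i,2h_i}-\delta^2_{x_i,h_i})U_\alpha$. Numerical operator, for $\mathbf{x}_\alpha\in\mathcal{T}_{\mathbf{h}}\cap\Omega$: $$\widehat{L}^\epsilon_{\mathbf{h}}[U_\alpha]=-\sigma\sum_{i=1}^d h_i^2\delta^2_{x_i,h_i}U_\alpha-\epsilon\Delta_{\mathbf{h}}U_\alpha+\mathbf{b}\cdot\nabla_{\mathbf{h}}U_\alpha+c(\mathbf{x}_\alpha)U_\alpha+\gamma M^p_{\mathbf{h}}U_\alpha .$$ Norm: $\|U-u\|_{\ell^2(\mathcal{T}_{\mathbf{h}}\cap\Omega)}=\big(\sum_{\mathbf{x}_\alpha\in\mathcal{T}_{\mathbf{h}}\cap\Omega}|U_\alpha-u(\mathbf{x}_\alpha)|^2\big)^{1/2}$. Under the stated hypotheses the scheme has a unique solution. The constant $C$ may depend on $u,\Omega,\epsilon,\mathbf{b},c,\sigma,\gamma,p$. *)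

(* Defs.v *)
From HB Require Import structures.
From mathcomp Require Import all_boot all_order all_algebra.
From mathcomp Require Import all_classical all_reals all_analysis.
Set Implicit Arguments.
Unset Strict Implicit.
Unset Printing Implicit Defensive.
Import Order.TTheory GRing.Theory Num.Theory.
Import numFieldNormedType.Exports.
Local Open Scope classical_set_scope.
Local Open Scope ring_scope.

Section Domain.
Variables (R : realType) (d : nat).
Implicit Types (x : 'rV[R]_d) (D : set 'rV[R]_d) (v : 'rV[R]_d -> R).

Definition box (a b : 'rV[R]_d) : set 'rV[R]_d :=
  [set x | forall i, a 0 i < x 0 i < b 0 i].

Definition frontier D : set 'rV[R]_d := closure D `\` interior D.

Definition partial (i : 'I_d) v : 'rV[R]_d -> R :=
  fun x => 'D_(delta_mx 0 i) v x.

Definition extends_continuously D v : Prop :=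
  exists w : 'rV[R]_d -> R,
    {within closure D, continuous w} /\ forall x, D x -> w x = v x.

(* Every iterated partial derivative of order at most k exists on D and
   extends continuously to the closure of D. *)
Fixpoint smooth_up_to (k : nat) D v : Prop :=
  extends_continuously D v /\
  match k with
  | 0 => True
  | k'.+1 => forall i : 'I_d,
      (forall x, D x -> derivable v x (delta_mx 0 i)) /\
      smooth_up_to k' D (partial i v)
  end.

(* C^k of the closure of the open set D. The first conjunct makes the values
   of v on the boundary the limits of its values inside. *)
Definition Ck_closure (k : nat) D v : Prop :=
  {within closure D, continuous v} /\ smooth_up_to k D v.

Definition grad v x : 'rV[R]_d := \row_i partial i v x.

Definition laplacian v x : R := \sum_(i < d) partial i (partial i v) x.

Definition dot (x y : 'rV[R]_d) : R := \sum_(i < d) x 0 i * y 0 i.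

Definition bvp_solution D (eps : R) (beta : 'rV[R]_d)
    (c f g u : 'rV[R]_d -> R) : Prop :=
  (forall x, D x ->
     - eps * laplacian u x + dot beta (grad u x) + c x * u x = f x) /\
  (forall x, frontier D x -> u x = g x).

End Domain.

Section Mesh.
Variables (R : realType) (d : nat) (a b : 'rV[R]_d) (J : 'I_d -> nat).
(* Multi-indices are integer row vectors, grid indices running from 1 to J i in
   direction i, so that ghost points have index 0 or J i + 1. *)
Implicit Types (al : 'rV[int]_d).

Definition mesh_step (i : 'I_d) : R := (b 0 i - a 0 i) / ((J i)%:R - 1).

Definition mesh_size : R := \big[Num.max/0]_(i < d) mesh_step i.

Definition node al : 'rV[R]_d :=
  \row_i (a 0 i + (al 0 i - 1)%:~R * mesh_step i).

Definition grid : set 'rV[int]_d :=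
  [set al | forall i, 1 <= al 0 i <= (J i)%:Z].

Definition inner_grid : set 'rV[int]_d :=
  grid `&` [set al | box a b (node al)].

Definition boundary_grid : set 'rV[int]_d :=
  grid `&` [set al | frontier (box a b) (node al)].

Definition ghosted (i : 'I_d) : set 'rV[int]_d :=
  boundary_grid `&`
  [set al | inner_grid (al + delta_mx 0 i) \/ inner_grid (al - delta_mx 0 i)].

(* The sums over inner_grid below are finite sums. *)
Lemma finite_inner_grid : finite_set inner_grid.
Proof.
pose N := (\max_(i < d) J i).+1.
pose F (s : {ffun 'I_d -> 'I_N}) : 'rV[int]_d := \row_i (s i : nat)%:Z.
apply: (@sub_finite_set _ _ (F @` setT)); last first.
  exact/finite_image/finite_finset.
move=> al [gal _] /=.
exists [ffun i => inord `|al ord0 i|%N] => //.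
apply/rowP => i; rewrite !mxE ffunE.
have /andP[al1 alJ] := gal i.
have al0 : 0 <= al 0 i by apply: le_trans al1.
rewrite inordK ?gez0_abs// ltnS.
apply: leq_trans (leq_bigmax i).
by rewrite -lez_nat gez0_abs.
Qed.

End Mesh.

Section Scheme.
Variables (R : realType) (d : nat) (h : 'I_d -> R).
(* Only the values of a grid function on the grid and at the ghost points are
   relevant, the others being left unconstrained. *)
Implicit Types (U : 'rV[int]_d -> R) (al : 'rV[int]_d) (i : 'I_d).

Definition delta1 i U al : R :=
  (U (al + delta_mx 0 i) - U (al - delta_mx 0 i)) / (2 * h i).

Definition delta2 i U al : R :=
  (U (al + delta_mx 0 i) - 2 * U al + U (al - delta_mx 0 i)) / h i ^+ 2.

Definition delta2_double i U al : R :=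
  (U (al + delta_mx 0 i *+ 2) - 2 * U al + U (al - delta_mx 0 i *+ 2))
  / (4 * h i ^+ 2).

Definition grad_h U al : 'rV[R]_d := \row_i delta1 i U al.

Definition laplacian_h U al : R := \sum_(i < d) delta2 i U al.

Definition numerical_moment (p : R) U al : R :=
  \sum_(i < d) h i `^ p * (delta2_double i U al - delta2 i U al).

Definition numerical_operator (eps sigma gamma p : R) (beta : 'rV[R]_d)
    (cal : R) U al : R :=
  - sigma * (\sum_(i < d) h i ^+ 2 * delta2 i U al)
  - eps * laplacian_h U al + dot beta (grad_h U al) + cal * U al
  + gamma * numerical_moment p U al.

Definition l2_norm (A : set 'rV[int]_d) (V : 'rV[int]_d -> R) : R :=
  Num.sqrt (\sum_(al \in A) `|V al| ^+ 2).

End Scheme.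

Definition scheme_solution (R : realType) (d : nat) (a b : 'rV[R]_d)
    (J : 'I_d -> nat) (eps sigma gamma p : R) (beta : 'rV[R]_d)
    (c f g : 'rV[R]_d -> R) (U : 'rV[int]_d -> R) : Prop :=
  [/\ forall al, inner_grid a b J al ->
        numerical_operator (mesh_step a b J) eps sigma gamma p beta
          (c (node a b J al)) U al = f (node a b J al),
      forall al, boundary_grid a b J al -> U al = g (node a b J al)
    & forall i al, ghosted a b J i al -> - delta2 (mesh_step a b J) i U al = 0].

(* Main.v *)
(** Let [e = U - u] on the interior nodes, extended by zero. In each direction the
    numerical moment is [h_i^(p+2) / 4] times the iterated second difference, and
    the ghost condition says that the inner second difference of [U] vanishes at
    boundary nodes. Cutting the second differences of [u] off at the boundary in
    the same way, summation by parts makes the moment of [e] contribute a sum of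
    squares, the centered first differences contribute nothing, and the diffusion
    (through a discrete Poincare inequality) or the reaction controls [|e|^2].
    Hence [|e|] is bounded by the truncation error. That error is [O(h^(p+1/2))]
    at all nodes by Taylor expansion, except on the layer of nodes adjacent to the
    boundary, where the cut-off costs [h_i^p]; the layer in direction [i] has
    volume [O(h_i)], which gives the missing factor [h^(1/2)]. *)

Require Import Defs.
From HB Require Import structures.
From mathcomp Require Import all_boot all_order all_algebra.
From mathcomp Require Import all_classical all_reals all_analysis.
From mathcomp Require Import zify ring lra.
Set Implicit Arguments.
Unset Strict Implicit.
Unset Printing Implicit Defensive.
Import Order.TTheory GRing.Theory Num.Theory.
Import numFieldNormedType.Exports.
Local Open Scope classical_set_scope.
Local Open Scope ring_scope.

(** * Discrete energy method *)

Section SummationByParts.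
Context {R : realFieldType} {V : zmodType} (A : seq V) (A_uniq : uniq A) (e : V).
Implicit Types (E Z F G : V -> R) (x : V).

Definition off_zero F := forall x, x \notin A -> F x = 0.

Lemma eq_sum_support (s t : seq V) F : uniq s -> uniq t ->
  (forall x, F x != 0 -> (x \in s) = (x \in t)) ->
  \sum_(x <- s) F x = \sum_(x <- t) F x.
Proof.
move=> us ut st.
rewrite [LHS](bigID (fun x => F x == 0)) [RHS](bigID (fun x => F x == 0)) /=.
congr (_ + _); first by rewrite !big1// => x /eqP.
rewrite -[LHS]big_filter -[RHS]big_filter; apply: perm_big.
apply: uniq_perm; rewrite ?filter_uniq// => x.
by rewrite !mem_filter; case: eqVneq => //= Fx; rewrite st.
Qed.

Let s := undup (A ++ [seq x + e | x <- A] ++ [seq x - e | x <- A]).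

Let sum_neighbors F : off_zero F ->
  \sum_(x <- A) F x = \sum_(x <- s) F x.
Proof.
move=> F0; apply: eq_sum_support; rewrite ?undup_uniq// => x Fx.
rewrite mem_undup mem_cat; case: (boolP (x \in A)) => //= xA.
by rewrite F0 ?eqxx in Fx.
Qed.

(** Both [s] and its translate by [e] contain [A], hence the support of [G], so telescoping leaves
    no boundary term. The identities below all exhibit their summand as such a difference. *)
Let sum_shift G : off_zero G ->
  \sum_(x <- s) (G (x + e) - G x) = 0.
Proof.
move=> G0; rewrite sumrB; apply/eqP; rewrite subr_eq0; apply/eqP.
rewrite -(big_map (fun x => x + e) xpredT) /=.
apply: eq_sum_support; rewrite ?undup_uniq//.
  by rewrite map_inj_uniq ?undup_uniq//; apply: addIr.
move=> x Gx; have xA : x \in A.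
  by apply: contraNT Gx => /G0 ->.
rewrite mem_undup mem_cat xA /=; apply/mapP.
exists (x - e); last by rewrite subrK.
by rewrite mem_undup !mem_cat (map_f (fun x => x - e))// !orbT.
Qed.

(** Antisymmetry of the centered difference: the summand is the forward difference of
    [E x * E (x - e)]. *)
Lemma sum_centered_diff E : off_zero E ->
  \sum_(x <- A) (E (x + e) - E (x - e)) * E x = 0.
Proof.
move=> E0; rewrite sum_neighbors; last by move=> x /E0 ->; rewrite mulr0.
rewrite -[RHS](@sum_shift (fun x => E x * E (x - e))).
  by apply: eq_bigr => x _; rewrite addrK; ring.
by move=> x /E0 ->; rewrite mul0r.
Qed.

(** Discrete Green identity: the two summands differ by the forward difference of a discrete
    Wronskian of [Z] and [E]. It is applied with [Z] the cut-off second difference of [E]. *)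
Lemma sum_diff2_sym E Z : off_zero E -> off_zero Z ->
  \sum_(x <- A) (Z (x + e) - 2 * Z x + Z (x - e)) * E x =
  \sum_(x <- A) Z x * (E (x + e) - 2 * E x + E (x - e)).
Proof.
move=> E0 Z0; rewrite [LHS]sum_neighbors; last by move=> x /E0 ->; rewrite mulr0.
rewrite [RHS]sum_neighbors; last by move=> x xA; rewrite Z0// mul0r.
apply/eqP; rewrite -subr_eq0 -sumrB; apply/eqP.
rewrite -[RHS](@sum_shift (fun x => Z x * E (x - e) - Z (x - e) * E x)).
  by apply: eq_bigr => x _; rewrite addrK; ring.
by move=> x xA; rewrite (E0 x)// (Z0 x)// mul0r mulr0 subrr.
Qed.

(** The right-hand sum runs over [s] because the edge entering [A] from outside also carries
    energy. *)
Let sum_diff2_energy E : off_zero E ->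
  \sum_(x <- A) (E (x + e) - 2 * E x + E (x - e)) * E x =
  - \sum_(x <- s) (E (x + e) - E x) ^+ 2.
Proof.
move=> E0; rewrite sum_neighbors; last by move=> x /E0 ->; rewrite mulr0.
apply/eqP; rewrite -addr_eq0 -big_split; apply/eqP => /=.
rewrite -[RHS](@sum_shift (fun x => E x ^+ 2 - E x * E (x - e))).
  by apply: eq_bigr => x _; rewrite addrK; ring.
by move=> x /E0 ->; rewrite mul0r expr0n subrr.
Qed.

Lemma sum_diff2_le0 E : off_zero E ->
  \sum_(x <- A) (E (x + e) - 2 * E x + E (x - e)) * E x <= 0.
Proof.
move=> E0; rewrite sum_diff2_energy// oppr_le0.
by apply: sumr_ge0 => x _; exact: sqr_ge0.
Qed.

(* Summing the telescoping difference of [w * E ^+ 2] gives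
   [sum E ^+ 2 = - sum w (E (x + e) - E x) (E (x + e) + E x)]; then AM-GM. *)
Lemma discrete_poincare E (w : V -> R) (N : R) : off_zero E ->
  (forall x, w (x + e) = w x + 1) ->
  (forall x, (x \in A) || (x + e \in A) -> `|w x| <= N) ->
  \sum_(x <- A) E x ^+ 2 <=
  4 * N ^+ 2 * - \sum_(x <- A) (E (x + e) - 2 * E x + E (x - e)) * E x.
Proof.
move=> E0 we wN; rewrite sum_diff2_energy// opprK.
rewrite sum_neighbors; last by move=> x /E0 ->; rewrite expr0n.
have shE : \sum_(x <- s) (E (x + e) ^+ 2 - E x ^+ 2) = 0.
  by apply: (@sum_shift (fun x => E x ^+ 2)) => x /E0 ->; rewrite expr0n.
have shw : \sum_(x <- s) (w (x + e) * E (x + e) ^+ 2 - w x * E x ^+ 2) = 0.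
  apply: (@sum_shift (fun x => w x * E x ^+ 2)) => x /E0 ->.
  by rewrite expr0n mulr0.
rewrite -subr_ge0 mulr_sumr -sumrB.
(* Both added sums vanish. With [D] and [S] the difference and the sum of [E (x + e)] and [E x], the
   weights 3/2 and 2 turn the summand into [4 (N^2 - w^2) D^2 + (2 w D + S/2)^2 + D^2/4]. *)
have -> : \sum_(x <- s) (4 * N ^+ 2 * (E (x + e) - E x) ^+ 2 - E x ^+ 2) =
    \sum_(x <- s) (4 * N ^+ 2 * (E (x + e) - E x) ^+ 2 - E x ^+ 2
      - 3 / 2 * (E (x + e) ^+ 2 - E x ^+ 2)
      + 2 * (w (x + e) * E (x + e) ^+ 2 - w x * E x ^+ 2)).
  rewrite [RHS]big_split/= [in RHS]sumrB -[X in _ - X]mulr_sumr.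
  by rewrite -[X in _ - _ + X]mulr_sumr shE shw !mulr0 subr0 addr0.
apply: sumr_ge0 => x _; rewrite we.
have [xA|] := boolP ((x \in A) || (x + e \in A)); last first.
  by rewrite negb_or => /andP[/E0 -> /E0 ->]; rewrite !(expr0n, mulr0, subr0, addr0).
have w2 : 0 <= (N ^+ 2 - w x ^+ 2) * (E (x + e) - E x) ^+ 2.
  rewrite mulr_ge0 ?sqr_ge0// subr_ge0 -[leLHS]real_normK ?num_real//.
  by rewrite lerXn2r ?nnegrE ?(le_trans _ (wN _ xA))// wN.
have := sqr_ge0 (2 * w x * (E (x + e) - E x) + (E (x + e) + E x) / 2).
have := sqr_ge0 (E (x + e) - E x).
by lra.
Qed.

End SummationByParts.

Section EnergyEstimate.
Context {R : realFieldType} {V : zmodType} {d : nat}.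
Variables (A : seq V) (A_uniq : uniq A) (e : 'I_d -> V) (E : V -> R).

Let Q i (F : V -> R) x := F (x + e i) - 2 * F x + F (x - e i).

(** Test the error equation with [E]. The centered terms drop out, and by symmetry the moment
    becomes a nonnegative multiple of the sum of [Z i x ^+ 2], which is discarded. What remains is
    the coercive form, bounded by the product of [tau] and [E]. *)
Lemma energy_estimate (Z tau : 'I_d -> V -> R) (p q r : 'I_d -> R)
    (c : V -> R) (kappa : R) :
  (0 < d)%N -> off_zero A E -> (forall i, off_zero A (Z i)) ->
  (forall i x, x \in A -> Z i x = Q i E x) ->
  (forall i, 0 <= r i) -> 0 < kappa ->
  kappa * \sum_(x <- A) E x ^+ 2 <=
    \sum_i p i * - \sum_(x <- A) Q i E x * E x + \sum_(x <- A) c x * E x ^+ 2 ->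
  (forall x, x \in A ->
    \sum_i (- p i * Q i E x + q i * (E (x + e i) - E (x - e i))
      + r i * Q i (Z i) x) + c x * E x = \sum_i tau i x) ->
  \sum_(x <- A) E x ^+ 2 <=
    d%:R / kappa ^+ 2 * \sum_i \sum_(x <- A) tau i x ^+ 2.
Proof.
move=> d_gt0 E0 Z0 ZE r0 k0 coercive eqn.
have dR : 0 < d%:R :> R by rewrite ltr0n.
have energy : kappa * \sum_(x <- A) E x ^+ 2 <=
    \sum_(x <- A) \sum_i tau i x * E x.
  apply: (le_trans coercive).
  have -> : \sum_(x <- A) \sum_i tau i x * E x =
      \sum_i (p i * - \sum_(x <- A) Q i E x * E x + r i * \sum_(x <- A) Z i x ^+ 2)
      + \sum_(x <- A) c x * E x ^+ 2.
    rewrite big_seq; under eq_bigr => x xA.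
      rewrite -mulr_suml -eqn// mulrDl mulr_suml -mulrA -expr2.
      over.
    rewrite -big_seq big_split /=; congr (_ + _).
    rewrite exchange_big; apply: eq_bigr => i _ /=.
    under eq_bigr do rewrite !mulrDl -!mulrA.
    rewrite !big_split /= -!mulr_sumr (sum_centered_diff A_uniq)// mulr0 addr0.
    rewrite mulrN mulNr; congr (_ + _ * _).
    rewrite [LHS](sum_diff2_sym A_uniq)// !big_seq.
    by apply: eq_bigr => x xA; rewrite ZE// expr2.
  rewrite lerD2r; apply: ler_sum => i _; rewrite lerDl mulr_ge0//.
  by apply: sumr_ge0 => x _; exact: sqr_ge0.
(* Young's inequality with weights [d / (2 kappa)] and [kappa / (2 d)]: over the [d] directions the
   second parts add up to half of the coercive term, which is then absorbed. *)
have young : \sum_(x <- A) \sum_i tau i x * E x <=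
    d%:R / (2 * kappa) * \sum_i \sum_(x <- A) tau i x ^+ 2
    + kappa / 2 * \sum_(x <- A) E x ^+ 2.
  rewrite exchange_big.
  have -> : kappa / 2 * \sum_(x <- A) E x ^+ 2 =
      \sum_(i < d) \sum_(x <- A) kappa / (2 * d%:R) * E x ^+ 2.
    rewrite sumr_const card_ord -mulr_sumr -mulr_natl; field.
    by rewrite gt_eqF.
  rewrite mulr_sumr -big_split; apply: ler_sum => i _ /=.
  rewrite mulr_sumr -big_split; apply: ler_sum => x _ /=.
  rewrite -subr_ge0.
  have -> : d%:R / (2 * kappa) * tau i x ^+ 2 + kappa / (2 * d%:R) * E x ^+ 2
      - tau i x * E x =
    (d%:R * tau i x - kappa * E x) ^+ 2 / (2 * kappa * d%:R).
    by field; rewrite !gt_eqF.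
  by rewrite divr_ge0 ?sqr_ge0// !mulr_ge0// ltW.
rewrite -(ler_pM2l (x := kappa / 2)) ?divr_gt0//.
have -> : kappa / 2 * (d%:R / kappa ^+ 2 * \sum_i \sum_(x <- A) tau i x ^+ 2) =
    d%:R / (2 * kappa) * \sum_i \sum_(x <- A) tau i x ^+ 2.
  by field; rewrite gt_eqF.
by move: energy young; lra.
Qed.
End EnergyEstimate.

(** * Taylor expansion along coordinate lines *)

Lemma is_derive_taylor_poly (R : realType) n (a : nat -> R) (t : R) :
  is_derive t (1 : R) (fun x : R => \sum_(k < n.+1) a k * (x ^+ k / k`!%:R))
    (\sum_(k < n) a k.+1 * (t ^+ k / k`!%:R)).
Proof.
pose P : {poly R} := \sum_(k < n.+1) (a k / k`!%:R) *: 'X^k.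
have -> : (fun x : R => \sum_(k < n.+1) a k * (x ^+ k / k`!%:R)) = horner P.
  apply/funext => x; rewrite horner_sum; apply: eq_bigr => k _.
  by rewrite hornerZ hornerXn mulrA mulrAC.
suff -> : \sum_(k < n) a k.+1 * (t ^+ k / k`!%:R) = P^`().[t].
  exact: is_derive_poly.
rewrite linear_sum/= horner_sum big_ord_recl/= expr0 linearZ/= derivC.
rewrite scaler0 horner0 add0r; apply: eq_bigr => k _.
rewrite linearZ/= derivXn hornerZ hornerMn hornerXn/= /bump leq0n add1n.
rewrite factS natrM -mulr_natr; field.
by rewrite nat1r !pnatr_eq0 -lt0n fact_gt0.
Qed.

Lemma taylor_poly0 (R : realFieldType) n (a : nat -> R) :
  \sum_(k < n.+1) a k * (0 ^+ k / k`!%:R) = a 0%N.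
Proof.
rewrite big_ord_recl big1 ?addr0 /= ?fact0 ?expr0 ?divr1 ?mulr1// => k _.
by rewrite expr0n /= mul0r mulr0.
Qed.

(* The interval is kept inside [0, 1] so that the powers of [T] in the remainder
   need not be recorded. *)
Lemma taylor_remainder (R : realType) n (phi : nat -> R -> R) (K T : R) :
  0 <= T <= 1 ->
  (forall k t, (k < n.+1)%N -> 0 <= t < T ->
    is_derive t (1 : R) (phi k) (phi k.+1 t)) ->
  {within `[0, T], continuous (phi 0%N)} ->
  (forall t, 0 <= t < T -> `|phi n.+1 t| <= K) -> 0 <= K ->
  `|phi 0%N T - \sum_(k < n.+1) phi k 0 * (T ^+ k / k`!%:R)| <= K.
Proof.
elim: n phi T => [|n IH] phi T /andP[T0 T1] dphi cphi phiK K0;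
  (have [->|TN0] := eqVneq T 0; first by
    rewrite (taylor_poly0 _ (phi^~ 0)) subrr normr0);
  have {TN0}T0' : 0 < T by rewrite lt_def TN0.
- have dphi0 x : x \in `]0, T[ -> is_derive x (1 : R) (phi 0%N) (phi 1%N x).
    by rewrite in_itv/= => /andP[/ltW x0 xT]; apply: dphi; rewrite ?x0.
  have [c] := MVT T0' dphi0 cphi.
  rewrite in_itv/= => /andP[/ltW c0 cT].
  rewrite big_ord1 expr0 fact0 divr1 mulr1 => ->.
  rewrite normrM subr0 (ger0_norm T0) -[leRHS]mulr1 ler_pM// phiK//.
  by rewrite c0.
(* The derivative of the remainder [r] is the remainder of one order less for [phi 1]. Since
   [r 0 = 0], the mean value theorem reduces the claim to the induction hypothesis on a shorter
   interval. *)
pose r t := phi 0%N t - \sum_(k < n.+2) phi k 0 * (t ^+ k / k`!%:R).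
pose dr t := phi 1%N t - \sum_(k < n.+1) phi k.+1 0 * (t ^+ k / k`!%:R).
have r0 : r 0 = 0 by rewrite /r (taylor_poly0 _ (phi^~ 0)) subrr.
have dP t := @is_derive_taylor_poly R n.+1 (fun k => phi k 0) t.
have dr0 x : x \in `]0, T[ -> is_derive x (1 : R) r (dr x).
  rewrite in_itv/= => /andP[/ltW x0 xT].
  by apply: is_deriveB; apply: dphi; rewrite ?x0.
have cr : {within `[0, T], continuous r}.
  move=> t; apply: (@continuousB _ _ _ (phi 0%N : subspace `[0, T] -> R)).
    exact: cphi.
  apply: derivable_within_continuous => x _.
  exact: (@ex_derive _ _ _ _ _ _ _ (dP x)).
have [c] := MVT T0' dr0 cr.
rewrite in_itv/= => /andP[/ltW c0 cT].
rewrite r0 !subr0 -/(r T) => ->.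
rewrite normrM (ger0_norm T0) -[leRHS]mulr1 ler_pM//.
apply: (IH (fun k => phi k.+1)) => //.
- by rewrite c0 (le_trans (ltW cT)).
- move=> k t kn /andP[t0 tc]; apply: dphi => //.
  by rewrite t0 (lt_trans tc).
- apply: derivable_within_continuous => x; rewrite in_itv/= => /andP[x0 xc].
  have /dphi d1 : 0 <= x < T by rewrite x0 (le_lt_trans xc).
  exact: (@ex_derive _ _ _ _ _ _ _ (d1 1%N isT)).
- move=> t /andP[t0 tc]; apply: phiK.
  by rewrite t0 (lt_trans tc).
Qed.

(** * The box, its closure, and segments along coordinate directions *)

Section Box.
Context {R : realType} {d : nat} (a b : 'rV[R]_d).
Hypothesis ab : forall i, a 0 i < b 0 i.
Implicit Types (x : 'rV[R]_d) (i : 'I_d).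

Definition closed_box : set 'rV[R]_d :=
  [set x | forall i, a 0 i <= x 0 i <= b 0 i].

Lemma compact_closed_box : compact closed_box.
Proof.
have := @rV_compact R d (fun i => `[a 0 i, b 0 i]%classic).
rewrite (_ : mkset _ = closed_box).
  by apply=> i /=; exact: segment_compact.
by apply/seteqP; split => x /= xab i; have := xab i; rewrite in_itv.
Qed.

Lemma closure_box : closure (box a b) = closed_box.
Proof.
have /closure_id cb : closed closed_box.
  exact: compact_closed (@norm_hausdorff R 'rV[R]_d) compact_closed_box.
apply/seteqP; split => [|x xab].
  rewrite [X in _ `<=` X]cb; apply: closure_subset => x xab i.
  by have /andP[/ltW -> /ltW ->] := xab i.
(* [l] moves from [x] towards the center of the box, reached at [t = 1/2]; for [0 < t < 1/2] it
   stays in the open box. *)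
move=> B; pose l (t : R) := x + t *: ((a + b) *+ 1 - x *+ 2).
have l0 : l 0 = x by rewrite /l scale0r addr0.
have cl : l t @[t --> 0] --> l 0.
  apply: cvgD; first exact: cvg_cst.
  by apply: cvgZr_tmp; exact: cvg_id.
rewrite -l0 => /(cvg_at_right_filter cl) Bl.
have [t [[t0 t1] Blt]] : exists t : R, (0 < t /\ t < 2^-1) /\ B (l t).
  apply: (@filter_ex _ (0 : R)^'+).
  near=> t; split; last by near: t.
  by split; near: t; [exact: nbhs_right_gt|apply: nbhs_right_lt].
exists (l t); split => // i; rewrite !mxE.
have := xab i; have := ab i; nra.
Unshelve. all: by end_near. Qed.

Lemma extends_bounded v : extends_continuously (box a b) v ->
  exists2 K : R, 0 <= K & forall x, box a b x -> `|v x| <= K.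
Proof.
move=> [w [cw wv]].
have /compact_bounded[M [_ wM]] : compact (w @` closed_box).
  rewrite closure_box in cw; apply: continuous_compact => //.
  exact: compact_closed_box.
exists (`|M| + 1) => [|x xab]; first by rewrite addr_ge0.
rewrite -wv//; apply: wM; first by rewrite (le_lt_trans (ler_norm _))// ltrDl.
by exists x => //; rewrite -closure_box; exact: subset_closure.
Qed.

(** Only the far end of the segment can touch the boundary, so derivatives are available at every
    parameter [t < 1]. *)
Lemma box_segment i x (s t : R) : box a b x ->
  closed_box (x + s *: delta_mx 0 i) -> 0 <= t < 1 ->
  box a b (x + (t * s) *: delta_mx 0 i).
Proof.
move=> xab sab /andP[t0 t1] j.
have /andP[x1 x2] := xab j; have := sab j; rewrite !mxE => /andP[s1 s2].
by apply/andP; split; nra.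
Qed.

Lemma box_segment_closed i x (s t : R) : box a b x ->
  closed_box (x + s *: delta_mx 0 i) -> 0 <= t <= 1 ->
  closed_box (x + (t * s) *: delta_mx 0 i).
Proof.
move=> xab sab /andP[t0 t1] j.
have /andP[x1 x2] := xab j; have := sab j; rewrite !mxE => /andP[s1 s2].
by apply/andP; split; nra.
Qed.

End Box.

Lemma smooth_up_to_iter (R : realType) (d : nat) (D : set 'rV[R]_d) i k j v :
  smooth_up_to (k + j) D v -> smooth_up_to j D (iter k (partial i) v).
Proof.
elim: k v => // k IH v [_ /(_ i)[_ /IH]].
by rewrite iterSr.
Qed.

Lemma smooth_up_to_le (R : realType) (d : nat) (D : set 'rV[R]_d) k m v :
  (k <= m)%N -> smooth_up_to m D v -> smooth_up_to k D v.
Proof.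
elim: m k v => [|m IH] [|k] v //= km [ev dv]; split => // i.
by have [dvi svi] := dv i; split => //; exact: IH svi.
Qed.

Lemma smooth_up_to_derivable (R : realType) (d : nat) (D : set 'rV[R]_d) k v i x :
  smooth_up_to k.+1 D v -> D x -> derivable v x (delta_mx 0 i).
Proof. by move=> [_ /(_ i)[+ _]]; apply. Qed.

Lemma smooth_up_to_extends (R : realType) (d : nat) (D : set 'rV[R]_d) k v :
  smooth_up_to k D v -> extends_continuously D v.
Proof. by case: k => [|k] []. Qed.

(** Recentred at the point [y], the restriction [g] of [v] to the line has the directional
    derivative as its ordinary derivative at 0; the chain rule with an affine map gives the factor
    [s]. *)
Lemma is_derive_line (R : realType) (V : normedModType R) (v : V -> R) (x e : V)
    (s t : R) :
  derivable v (x + (t * s) *: e) e ->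
  is_derive t (1 : R) (fun t => v (x + (t * s) *: e))
    (s * 'D_e v (x + (t * s) *: e)).
Proof.
set y := x + _ => dv.
pose g (h : R) := v (h *: e + y).
have dg : is_derive (0 : R) (1 : R) g ('D_e v y).
  apply: DeriveDef; first exact: (derivable1P v y e).1.
  rewrite /derive; set F := (X in lim (X @ _)); set G := (X in _ = lim (X @ _)).
  suff -> : F = G by [].
  apply/funext => h; rewrite /F /G /=.
  by rewrite /g addr0 scale0r add0r [_%:A]mulr1.
have -> : (fun t => v (x + (t * s) *: e)) = g \o (fun r => (r - t) * s).
  apply/funext => r /=; rewrite /g /y addrCA -scalerDl -mulrDl subrK.
  by rewrite addrC.
rewrite (mulrC s); apply: is_derive1_comp; first by rewrite subrr mul0r.
have : is_derive t (1 : R) ((fun r : R => r - t) * cst s)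
    ((t - t) *: 0 + s *: (1 - 0)).
  apply: is_deriveM.
by rewrite subr0 scaler0 add0r [_%:A]mulr1.
Qed.

Section LineDifferences.
Context {R : realType} {d : nat} (a b : 'rV[R]_d).
Hypothesis ab : forall i, a 0 i < b 0 i.

(** The end point may lie on a face of the box, where [v] is known only to be continuous. This is
    why the one-variable remainder estimate asks for derivatives on a half-open interval. *)
Lemma taylor_line n (v : 'rV[R]_d -> R) i (K : R) x (s : R) :
  {within closure (box a b), continuous v} -> smooth_up_to n.+1 (box a b) v ->
  (forall y, box a b y -> `|iter n.+1 (partial i) v y| <= K) -> 0 <= K ->
  box a b x -> closed_box a b (x + s *: delta_mx 0 i) ->
  `|v (x + s *: delta_mx 0 i) -
    \sum_(k < n.+1) s ^+ k * iter k (partial i) v x / k`!%:R|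
  <= K * `|s| ^+ n.+1.
Proof.
move=> cv sv vK K0 xab sab; set e := delta_mx 0 i in sab *.
pose phi k t := s ^+ k * iter k (partial i) v (x + (t * s) *: e).
have := @taylor_remainder R n phi (K * `|s| ^+ n.+1) 1.
rewrite /phi /= mul1r expr0 mul1r ler01 lexx.
under eq_bigr do rewrite mul0r scale0r addr0 expr1n mulrA mulr1.
apply=> //.
- move=> k t kn t01.
  have dv : derivable (iter k (partial i) v) (x + (t * s) *: e) e.
    apply: smooth_up_to_derivable (box_segment xab sab t01).
    apply: (@smooth_up_to_iter _ _ _ _ _ (n.+1 - k).-1.+1).
    by rewrite prednK ?subn_gt0// subnKC// ltnW.
  rewrite exprSr -mulrA.
  exact: (is_deriveZ (s ^+ k) (is_derive_line dv)).
- rewrite (_ : (fun t : R => _) = fun t : R => v (x + (t * s) *: e)); last first.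
    by apply/funext => t; rewrite mul1r.
  apply/subspace_continuousP => t; rewrite /= in_itv/= => t01.
  have lD (r : R) : 0 <= r <= 1 -> closure (box a b) (x + (r * s) *: e).
    by move=> r01; rewrite closure_box//; exact: box_segment_closed.
  have cl : x + (r * s) *: e @[r --> t] --> x + (t * s) *: e.
    apply: cvgD; first exact: cvg_cst.
    by apply: cvgZr_tmp; apply: cvgMr_tmp; exact: cvg_id.
  move/subspace_continuousP : cv => /(_ _ (lD _ t01)) cv.
  move=> P /cv /cl; apply: (@filterS _ (nbhs t)) => r /= Pr.
  rewrite in_itv/= => r01.
  exact/Pr/lD.
- move=> t t01; rewrite normrM normrX mulrC ler_wpM2r ?exprn_ge0//.
  exact: vK (box_segment xab sab t01).
- by rewrite mulr_ge0 ?exprn_ge0.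
Qed.

Lemma finite_differences v : Ck_closure 5 (box a b) v ->
  exists2 K : R, 0 <= K & forall i x (h : R), 0 < h -> box a b x ->
    let e := h *: delta_mx 0 i in
    closed_box a b (x + e) -> closed_box a b (x - e) ->
    [/\ `|v (x + e) - v (x - e) - 2 * h * partial i v x| <= K * h ^+ 3,
        `|v (x + e) - 2 * v x + v (x - e) - h ^+ 2 * partial i (partial i v) x|
          <= K * h ^+ 4,
        `|v (x + e) - 2 * v x + v (x - e)| <= K * h ^+ 2 &
        closed_box a b (x + e *+ 2) -> closed_box a b (x - e *+ 2) ->
        `|v (x + e *+ 2) - 4 * v (x + e) + 6 * v x - 4 * v (x - e)
          + v (x - e *+ 2)| <= K * h ^+ 4].
Proof.
move=> [cv sv].
have [K K0 vK] : exists2 K : R, 0 <= K & forall i k, (k < 5)%N ->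
    forall x, box a b x -> `|iter k (partial i) v x| <= K.
  have bd (ik : 'I_d * 'I_5) : exists K : R, 0 <= K /\ forall x, box a b x ->
      `|iter ik.2 (partial ik.1) v x| <= K.
    have [|K K0 vK] := @extends_bounded _ _ a b ab (iter ik.2 (partial ik.1) v).
      apply: (@smooth_up_to_extends _ _ _ (5 - ik.2)).
      by apply: smooth_up_to_iter; rewrite subnKC// ltnW.
    by exists K.
  have [B BP] := choice bd.
  exists (\sum_ik B ik) => [|i k k5 x xab].
    by apply: sumr_ge0 => ik _; exact: (BP ik).1.
  apply: le_trans ((BP (i, Ordinal k5)).2 x xab) _.
  rewrite (bigD1 (i, Ordinal k5))//= lerDl.
  by apply: sumr_ge0 => ik _; exact: (BP ik).1.
(* The worst case is the fourth difference: the points at distance [2 * h] contribute [2 * 16] and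
   those at distance [h] contribute [2 * 4]. The Taylor polynomials of degree 3 cancel. *)
exists (40 * K) => [|i x h h0 xab e]; first by rewrite mulr_ge0.
have h0' := ltW h0.
have T n s : (n < 4)%N -> closed_box a b (x + s *: delta_mx 0 i) ->
    `|v (x + s *: delta_mx 0 i) -
      \sum_(k < n.+1) s ^+ k * iter k (partial i) v x / k`!%:R|
    <= K * `|s| ^+ n.+1.
  move=> n4; apply: taylor_line => //; last exact: vK.
  by apply: smooth_up_to_le sv; exact: ltnW.
pose D1 := partial i v x; pose D2 := partial i (partial i v) x.
pose D3 := partial i (partial i (partial i v)) x.
have T1 s : closed_box a b (x + s *: delta_mx 0 i) ->
    `|v (x + s *: delta_mx 0 i) - (v x + s * D1)| <= K * `|s| ^+ 2.
  move=> /(T 1%N _ isT); rewrite !big_ord_recr big_ord0 /=.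
  by rewrite add0r !divr1 expr0 mul1r expr1.
have T2 s : closed_box a b (x + s *: delta_mx 0 i) ->
    `|v (x + s *: delta_mx 0 i) - (v x + s * D1 + s ^+ 2 * D2 / 2)|
    <= K * `|s| ^+ 3.
  move=> /(T 2%N _ isT); rewrite !big_ord_recr big_ord0 /=.
  by rewrite add0r !divr1 expr0 mul1r expr1.
have T3 s : closed_box a b (x + s *: delta_mx 0 i) ->
    `|v (x + s *: delta_mx 0 i) -
      (v x + s * D1 + s ^+ 2 * D2 / 2 + s ^+ 3 * D3 / 6)|
    <= K * `|s| ^+ 4.
  move=> /(T 3%N _ isT); rewrite !big_ord_recr big_ord0 /=.
  by rewrite add0r !divr1 expr0 mul1r expr1.
have eN : - e = - h *: delta_mx 0 i by rewrite scaleNr.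
have e2 : e *+ 2 = (2 * h) *: delta_mx 0 i by rewrite -scaler_nat scalerA.
have e2N : - (e *+ 2) = - (2 * h) *: delta_mx 0 i by rewrite e2 scaleNr.
rewrite eN e2N e2 -/D1 -/D2 -/e => ce cNe.
have h20 : 0 <= 2 * h by rewrite mulr_ge0.
have Kh k : 0 <= K * h ^+ k by rewrite mulr_ge0// exprn_ge0.
have T1p := T1 _ ce; have T1m := T1 _ cNe.
have T2p := T2 _ ce; have T2m := T2 _ cNe.
have T3p := T3 _ ce; have T3m := T3 _ cNe.
move: (T3 (2 * h)) (T3 (- (2 * h))) T1p T1m T2p T2m T3p T3m.
rewrite !normrN (ger0_norm h0') (ger0_norm h20) -/e.
have -> : K * (2 * h) ^+ 4 = 16 * (K * h ^+ 4) by ring.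
rewrite -!(mulrA 40); clear T T1 T2 T3 sv cv vK ce cNe.
move: (closed_box a b _) (closed_box a b _) => c2e cN2e.
move: (v (x + e)) (v (x + - h *: _)) (v (x + (2 * h) *: _)) (v (x + - (2 * h) *: _)).
move: (v x) D1 D2 D3 => v0 D1 D2 D3 vp vm v2p v2m T3pp T3mm T1p T1m T2p T2m T3p T3m.
move: (Kh 2%N) (Kh 3%N) (Kh 4%N) T1p T1m T2p T2m T3p T3m.
move: T3pp T3mm; move: (K * h ^+ 2) (K * h ^+ 3) (K * h ^+ 4) => B2 B3 B4.
rewrite !ler_norml => T3pp T3mm B20 B30 B40 /andP[? ?] /andP[? ?] /andP[? ?].
move=> /andP[? ?] /andP[? ?] /andP[? ?].
split; [apply/andP; split; lra|apply/andP; split; lra|apply/andP; split; lra|].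
move=> /T3pp/andP[? ?] /T3mm/andP[? ?].
by apply/andP; split; lra.
Qed.
End LineDifferences.

(** * Mesh geometry *)

(** Code each vector by the positions of its coordinates in the lists [t i]. The code is injective
    on [s] and takes values in a product of index sets; [N] is a common bound putting all positions
    in one finite type. *)
Lemma size_le_prod_coord (d : nat) (s : seq 'rV[int]_d) (t : 'I_d -> seq int) :
  uniq s -> (forall al i, al \in s -> al 0 i \in t i) ->
  (size s <= \prod_(i < d) size (t i))%N.
Proof.
move=> us st; pose N := (\max_(i < d) size (t i)).+1.
have tN i : (size (t i) < N)%N by rewrite ltnS leq_bigmax.
pose code (al : 'rV[int]_d) : {ffun 'I_d -> 'I_N} :=
  [ffun i => inord (index (al 0 i) (t i))].
have codeE al i : al \in s -> code al i = index (al 0 i) (t i) :> nat.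
  move=> als; rewrite ffunE inordK// (leq_ltn_trans _ (tN i))//.
  exact: index_size.
have ucode : uniq (map code s).
  rewrite map_inj_in_uniq// => al1 al2 s1 s2 /ffunP e12; apply/rowP => i.
  have /(congr1 val) := e12 i; rewrite /= !codeE// => eqi.
  by rewrite -(nth_index 0 (st _ i s1)) eqi nth_index// st.
pose Q i := [pred k : 'I_N | (k < size (t i))%N].
have cardQ i : #|Q i| = size (t i).
  transitivity (\sum_(k < size (t i)) 1)%N.
    by rewrite (big_ord_widen N (fun=> 1%N)) ?(ltnW (tN i))// -sum1_card.
  by rewrite sum_nat_const card_ord muln1.
rewrite -(size_map code) -(card_uniqP ucode).
apply: (@leq_trans #|family Q|).
  apply/subset_leq_card/fintype.subsetP => _ /mapP[al als ->].
  by apply/familyP => i; rewrite inE codeE// index_mem st.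
rewrite -sum1_card.
apply/eq_leq/esym; transitivity (\prod_(i < d) \sum_(k | Q i k) 1)%N.
  by apply: eq_bigr => i _; rewrite -cardQ -sum1_card.
by rewrite bigA_distr_big_dep; apply: eq_bigr => f _; rewrite big1.
Qed.

Section MeshGeometry.
Context {R : realType} {d : nat} (a b : 'rV[R]_d) (J : 'I_d -> nat).
Hypothesis ab : forall i, a 0 i < b 0 i.
Hypothesis J3 : forall i, (3 <= J i)%N.
Implicit Types (al : 'rV[int]_d) (i : 'I_d).

Let JZ i : (J i)%:R - 1 = ((J i)%:Z - 1)%:~R :> R.
Proof. by rewrite rmorphB. Qed.

Let J_gt0 i : 0 < (J i)%:R - 1 :> R.
Proof. by rewrite subr_gt0 ltr1n (leq_trans _ (J3 i)). Qed.

Lemma mesh_stepE i : ((J i)%:R - 1) * mesh_step a b J i = b 0 i - a 0 i.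
Proof. by rewrite /mesh_step mulrC divfK// gt_eqF. Qed.

Lemma mesh_step_gt0 i : 0 < mesh_step a b J i.
Proof. by rewrite divr_gt0// subr_gt0. Qed.

Lemma mesh_step_le_size i : mesh_step a b J i <= mesh_size a b J.
Proof. by apply: le_bigmax. Qed.

Lemma nodeD al i (k : int) :
  node a b J (al + k *: delta_mx 0 i) =
  node a b J al + (k%:~R * mesh_step a b J i) *: delta_mx 0 i.
Proof.
apply/rowP => j; rewrite !mxE /=; case: (eqVneq j i) => [->|_] /=.
  by rewrite !mulr1 addrAC [X in X * _]rmorphD/= mulrDl addrA.
by rewrite !mulr0 !addr0.
Qed.

Lemma inner_gridP al :
  inner_grid a b J al <-> forall i, 2 <= al 0 i <= (J i)%:Z - 1.
Proof.
have lo i : (a 0 i < node a b J al 0 i) = (2 <= al 0 i).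
  by rewrite mxE ltrDl pmulr_lgt0 ?mesh_step_gt0// ltr0z; lia.
have hi i : (node a b J al 0 i < b 0 i) = (al 0 i <= (J i)%:Z - 1).
  rewrite mxE addrC -ltrBrDr -mesh_stepE JZ ltr_pM2r ?mesh_step_gt0//.
  by rewrite ltr_int; lia.
split=> [[_ /= bx] i|al2]; first by have := bx i; rewrite lo hi.
split=> /= i; last by rewrite lo hi.
by have /andP[? ?] := al2 i; lia.
Qed.

Lemma grid_closed_box al : grid J al -> closed_box a b (node a b J al).
Proof.
move=> gal i; have /andP[al1 alJ] := gal i.
rewrite mxE; apply/andP; split.
  by rewrite lerDl mulr_ge0 ?(ltW (mesh_step_gt0 _))// ler0z; lia.
rewrite addrC -lerBrDr -mesh_stepE JZ ler_wpM2r ?(ltW (mesh_step_gt0 _))//.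
by rewrite ler_int; lia.
Qed.

Lemma grid_boundary al : grid J al -> ~ inner_grid a b J al ->
  boundary_grid a b J al.
Proof.
move=> gal nal; split => //; split; rewrite /=.
  by rewrite closure_box//; exact: grid_closed_box.
by move=> /interior_subset bal; apply: nal.
Qed.

Lemma inner_grid_neighbor al i (k : int) : inner_grid a b J al -> `|k| <= 1 ->
  grid J (al + k *: delta_mx 0 i).
Proof.
move=> /inner_gridP al2 k1 j; rewrite !mxE/=.
by have := al2 j; case: (j == i) => /=; lia.
Qed.

End MeshGeometry.

(** * Counting interior nodes and boundary layers *)

Section InnerNodes.
Context {R : realType} {d : nat} (a b : 'rV[R]_d) (J : 'I_d -> nat).
Hypothesis ab : forall i, a 0 i < b 0 i.
Hypothesis J3 : forall i, (3 <= J i)%N.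

Definition inner_nodes : seq 'rV[int]_d :=
  finmap.enum_fset (fset_set (inner_grid a b J)).

Lemma inner_nodes_uniq : uniq inner_nodes.
Proof. exact: finmap.fset_uniq. Qed.

Lemma mem_inner_nodes al : reflect (inner_grid a b J al) (al \in inner_nodes).
Proof.
apply: (iffP idP); rewrite in_fset_set ?inE//; exact: finite_inner_grid.
Qed.

(** These are the interior nodes where the second difference in direction [i] of a cut-off function
    reaches beyond the cut-off. *)
Definition near_boundary i al :=
  (al + delta_mx 0 i \notin inner_nodes) || (al - delta_mx 0 i \notin inner_nodes).

Let inner_range i : seq int := [seq k%:Z | k <- iota 2 (J i - 2)].

Let mem_inner_range i (k : int) : 2 <= k <= (J i)%:Z - 1 -> k \in inner_range i.
Proof.
move=> k2; apply/mapP; exists `|k|%N; last by lia.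
by rewrite mem_iota; have := J3 i; lia.
Qed.

Let inner_range_size i :
  mesh_step a b J i * (size (inner_range i))%:R <= b 0 i - a 0 i.
Proof.
rewrite size_map size_iota -(mesh_stepE a b J3) mulrC.
rewrite ler_wpM2r ?(ltW (mesh_step_gt0 ab J3 i))// natrB ?(ltnW (J3 i))//.
by rewrite lerD2l lerN2 ler1n.
Qed.

Let mesh_volume_size (s : seq 'rV[int]_d) (t : 'I_d -> seq int) (m : 'I_d -> R) :
  uniq s -> (forall (al : 'rV[int]_d) i, al \in s -> al 0 i \in t i) ->
  (forall i, mesh_step a b J i * (size (t i))%:R <= m i) ->
  (\prod_i mesh_step a b J i) * (size s)%:R <= \prod_i m i.
Proof.
move=> us st tm.
have h0 i : 0 <= mesh_step a b J i by rewrite ltW// mesh_step_gt0.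
apply: (@le_trans _ _ (\prod_i (mesh_step a b J i * (size (t i))%:R))); last first.
  by apply: ler_prod => i _; rewrite (tm i) andbT mulr_ge0.
rewrite [leRHS]big_split /= ler_wpM2l ?prodr_ge0// -natr_prod ler_nat.
exact: size_le_prod_coord.
Qed.

Lemma mesh_volume_inner :
  (\prod_i mesh_step a b J i) * (size inner_nodes)%:R <=
  \prod_i (b 0 i - a 0 i).
Proof.
apply: (mesh_volume_size inner_nodes_uniq _ inner_range_size) => al i.
by move=> /mem_inner_nodes/(inner_gridP ab J3)/(_ i)/mem_inner_range.
Qed.

(** On the layer the [i]-th index takes only the values 2 and [J i - 1], so direction [i]
    contributes [2 * h_i] instead of the full side length. This factor [h_i] is the source of the
    extra half power. *)
Lemma mesh_volume_near_boundary i :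
  (\prod_j mesh_step a b J j) * (count (near_boundary i) inner_nodes)%:R <=
  2 * mesh_step a b J i * \prod_(j | j != i) (b 0 j - a 0 j).
Proof.
pose t j := if j == i then [:: 2; (J i)%:Z - 1] else inner_range j.
pose m j := if j == i then 2 * mesh_step a b J i else b 0 j - a 0 j.
rewrite -size_filter; apply: (le_trans (@mesh_volume_size _ t m _ _ _)).
- by rewrite filter_uniq// inner_nodes_uniq.
- move=> al j; rewrite mem_filter /t => /andP[nb /mem_inner_nodes al_inner].
  have /inner_gridP al2 := al_inner.
  have {}al2 := al2 ab J3.
  case: eqVneq => [->|_]; last exact/mem_inner_range.
  rewrite !inE; apply: contraLR nb; rewrite negb_or => /andP[/eqP n1 /eqP n2].
  rewrite negb_or !negbK.
  by apply/andP; split; apply/mem_inner_nodes/(inner_gridP ab J3) => k;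
    have := al2 k; rewrite !mxE /=; case: eqVneq => [->|] /=; lia.
- move=> j; rewrite /t /m; case: eqVneq => [->|_]; last exact: inner_range_size.
  by rewrite mulrC.
rewrite (bigD1 i)//= {1}/m eqxx; under eq_bigr do rewrite /m ifN//.
by [].
Qed.

End InnerNodes.

(** * Truncation error and stability of the scheme *)

Section SchemeError.
Context {R : realType} {d : nat} (a b beta : 'rV[R]_d) (J : 'I_d -> nat).
Variables (c f g u : 'rV[R]_d -> R) (eps sigma gamma p : R).
Variable (U : 'rV[int]_d -> R).
Hypothesis ab : forall i, a 0 i < b 0 i.
Hypothesis J3 : forall i, (3 <= J i)%N.
Hypothesis u_sol : bvp_solution (box a b) eps beta c f g u.
Hypothesis U_sol : scheme_solution a b J eps sigma gamma p beta c f g U.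
Implicit Types (al : 'rV[int]_d) (i : 'I_d) (F : 'rV[int]_d -> R).

Let A := inner_nodes a b J.
Let h := mesh_step a b J.
Let nu al := u (node a b J al).

Definition diff2 i F al :=
  F (al + delta_mx 0 i) - 2 * F al + F (al - delta_mx 0 i).

(** One extension by zero encodes two conditions: the Dirichlet condition when applied to the error,
    and the ghost condition when applied to second differences. *)
Definition inner_part F al := if al \in A then F al else 0.

Lemma inner_part_off F : off_zero A (inner_part F).
Proof. by move=> al; rewrite /inner_part => /negbTE ->. Qed.

Let E := inner_part (fun al => U al - nu al).
Let Wu i := inner_part (diff2 i nu).
Let WU i := inner_part (diff2 i U).

(* [u] has no ghost values: its second difference is cut off to 0 outside the
   interior nodes, which is what the ghost condition imposes on [U]. *)
Definition truncation_error i al : R :=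
  - eps * partial i (partial i u) (node a b J al)
  + beta 0 i * partial i u (node a b J al)
  + (sigma + eps / h i ^+ 2) * diff2 i nu al
  - beta 0 i / (2 * h i) * (nu (al + delta_mx 0 i) - nu (al - delta_mx 0 i))
  - gamma * h i `^ p / (4 * h i ^+ 2) * diff2 i (Wu i) al.

Let h_gt0 i : 0 < h i := mesh_step_gt0 ab J3 i.

Let gridD al i : al \in A -> grid J (al + delta_mx 0 i).
Proof.
move=> /mem_inner_nodes Aal.
by have := inner_grid_neighbor ab J3 (k := 1) i Aal; rewrite scale1r; apply.
Qed.

Let gridB al i : al \in A -> grid J (al - delta_mx 0 i).
Proof.
move=> /mem_inner_nodes Aal.
by have := inner_grid_neighbor ab J3 (k := -1) i Aal; rewrite scaleN1r; apply.
Qed.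

(** At boundary nodes [U] and [u] both equal [g], so the zero extension [E] is the true error on the
    whole grid. *)
Let U_grid al : grid J al -> U al = E al + nu al.
Proof.
move=> gal; rewrite /E /inner_part; case: ifPn => [_|nA]; first by rewrite subrK.
have [_ U_bd _] := U_sol; have [_ u_bd] := u_sol.
have bal : boundary_grid a b J al.
  by apply: grid_boundary => // /mem_inner_nodes; exact/negP.
by rewrite U_bd// add0r -u_bd//; case: bal.
Qed.

(** A non-interior grid node with an interior neighbor in direction [i] belongs to [ghosted i], and
    there the scheme makes the second difference of [U] vanish, in agreement with the cut-off. *)
Let diff2_U i al : grid J al ->
  [|| al \in A, al + delta_mx 0 i \in A | al - delta_mx 0 i \in A] ->
  diff2 i U al = WU i al.
Proof.
rewrite /WU /inner_part; case: ifPn => [//|alA] gal /= nA.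
have [_ _ /(_ i al) U_gh] := U_sol.
have /U_gh : ghosted a b J i al.
  split.
    by apply: grid_boundary => // /mem_inner_nodes; exact/negP.
  by case/orP: nA => /mem_inner_nodes; [left|right].
move/eqP; rewrite oppr_eq0 mulf_eq0 invr_eq0 expf_eq0/=.
rewrite [mesh_step _ _ _ _ == 0]gt_eqF//.
by rewrite orbF => /eqP.
Qed.

(** The right side is [4 * h i ^+ 2] times [delta2_double - delta2]. So the moment is an iterated
    second difference, and its ghost values are absorbed into the cut-off [WU]. *)
Let diff2_WU i al : al \in A ->
  diff2 i (WU i) al =
    U (al + delta_mx 0 i *+ 2) - 4 * U (al + delta_mx 0 i) + 6 * U al
    - 4 * U (al - delta_mx 0 i) + U (al - delta_mx 0 i *+ 2).
Proof.
move=> alA; rewrite {1}/diff2 -!diff2_U ?subrK ?addrK ?alA ?orbT//.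
- rewrite /diff2 addrK subrK mulr2n opprD !addrA; ring.
- exact: gridB.
- by case/mem_inner_nodes: alA.
- exact: gridD.
Qed.

(** Subtract the differential equation from the scheme, direction by direction. The cut-off is
    linear, so [WU] splits into the cut-off second differences of [E] and of [u]. *)
Lemma error_equation al : al \in A ->
  \sum_i (- (sigma + eps / h i ^+ 2) * diff2 i E al
    + beta 0 i / (2 * h i) * (E (al + delta_mx 0 i) - E (al - delta_mx 0 i))
    + gamma * h i `^ p / (4 * h i ^+ 2) * diff2 i (inner_part (diff2 i E)) al)
  + c (node a b J al) * E al = \sum_i truncation_error i al.
Proof.
move=> alA; have Aal := alA; move/mem_inner_nodes in Aal.
have Ual : U al = E al + nu al by apply: U_grid; case: Aal.
have diff2_UE i x : x \in A -> diff2 i U x = diff2 i E x + diff2 i nu x.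
  move=> xA; rewrite /diff2 (U_grid (gridD i xA)) (U_grid (gridB i xA)).
  by rewrite U_grid; [ring|case/mem_inner_nodes: xA].
have WUE i x : WU i x = inner_part (diff2 i E) x + Wu i x.
  by rewrite /WU /Wu /inner_part; case: ifP => [/diff2_UE|]; rewrite ?addr0.
have [Ueq _ _] := U_sol; have [ueq _] := u_sol.
pose w i := - eps * partial i (partial i u) (node a b J al)
  + beta 0 i * partial i u (node a b J al).
pose t i := - (sigma + eps / h i ^+ 2) * diff2 i U al
    + beta 0 i / (2 * h i) * (U (al + delta_mx 0 i) - U (al - delta_mx 0 i))
    + gamma * h i `^ p / (4 * h i ^+ 2) * diff2 i (WU i) al.
have Ut : numerical_operator (mesh_step a b J) eps sigma gamma p beta
    (c (node a b J al)) U al = \sum_i t i + c (node a b J al) * U al.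
  rewrite /numerical_operator /laplacian_h /dot /numerical_moment.
  rewrite addrAC; congr (_ + _).
  rewrite !mulr_sumr -sumrN -!big_split; apply: eq_bigr => i _ /=.
  rewrite /t diff2_WU// mxE /delta1 /delta2 /delta2_double /diff2.
  have := h_gt0 i; rewrite -/h; set hi := h i; set hp := _ `^ _ => hi0.
  by field; rewrite gt_eqF.
have uw : - eps * laplacian u (node a b J al)
    + dot beta (grad u (node a b J al)) = \sum_i w i.
  rewrite /laplacian /dot mulr_sumr -big_split; apply: eq_bigr => i _ /=.
  by rewrite mxE.
have := Ueq _ Aal; rewrite Ut -ueq; last by case: Aal.
(* The reaction term of [u] cancels, leaving the sum of [t] plus [c * E] equal to the sum of [w]. *)
rewrite uw Ual mulrDr addrA => /addIr eqn.
set lhs := \sum_i _; apply/esym/(addIr (- lhs)).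
suff -> : \sum_i truncation_error i al - lhs = \sum_i w i - \sum_i t i.
  by rewrite -eqn addrAC subrr add0r addrAC subrr add0r.
rewrite -!sumrB; apply: eq_bigr => i _; rewrite /t /w /truncation_error.
rewrite diff2_UE// (U_grid (gridD i alA)) (U_grid (gridB i alA)).
have -> : diff2 i (WU i) al =
    diff2 i (inner_part (diff2 i E)) al + diff2 i (Wu i) al.
  by rewrite /diff2 !WUE /diff2; ring.
by ring.
Qed.

(** * Pointwise size of the truncation error *)

Section Truncation.
Variables (K : R) (i : 'I_d).
Hypothesis K_ge0 : 0 <= K.
Hypothesis u_differences : forall x (s : R), 0 < s -> box a b x ->
    let e := s *: delta_mx 0 i in
    closed_box a b (x + e) -> closed_box a b (x - e) ->
    [/\ `|u (x + e) - u (x - e) - 2 * s * partial i u x| <= K * s ^+ 3,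
        `|u (x + e) - 2 * u x + u (x - e) - s ^+ 2 * partial i (partial i u) x|
          <= K * s ^+ 4,
        `|u (x + e) - 2 * u x + u (x - e)| <= K * s ^+ 2 &
        closed_box a b (x + e *+ 2) -> closed_box a b (x - e *+ 2) ->
        `|u (x + e *+ 2) - 4 * u (x + e) + 6 * u x - 4 * u (x - e)
          + u (x - e *+ 2)| <= K * s ^+ 4].

Let nodeDe al : node a b J (al + delta_mx 0 i) =
  node a b J al + h i *: delta_mx 0 i.
Proof. by have := nodeD a b J al i 1; rewrite scale1r mul1r. Qed.

Let nodeBe al : node a b J (al - delta_mx 0 i) =
  node a b J al - h i *: delta_mx 0 i.
Proof. by have := nodeD a b J al i (-1); rewrite !scaleN1r mulN1r scaleNr. Qed.

(** When both neighbors are interior, no cut-off acts in [diff2 i (Wu i) al]: it is a genuine fourth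
    difference of [u], and the points two steps away still lie in the closed box. *)
Let nu_differences al : al \in A ->
    [/\ `|nu (al + delta_mx 0 i) - nu (al - delta_mx 0 i)
          - 2 * h i * partial i u (node a b J al)| <= K * h i ^+ 3,
        `|diff2 i nu al - h i ^+ 2 * partial i (partial i u) (node a b J al)|
          <= K * h i ^+ 4,
        `|diff2 i nu al| <= K * h i ^+ 2 &
        ~~ near_boundary a b J i al -> `|diff2 i (Wu i) al| <= K * h i ^+ 4].
Proof.
move=> alA; have [_ /= bal] : inner_grid a b J al by apply/mem_inner_nodes.
have := u_differences (h_gt0 i) bal; rewrite /= -nodeDe -nodeBe.
move=> /(_ (grid_closed_box ab J3 (gridD i alA))).
move=> /(_ (grid_closed_box ab J3 (gridB i alA))).
move=> [d1 d2 d2' d4]; split => // nb.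
move: nb; rewrite negb_or !negbK => /andP[Dal Bal].
have -> : diff2 i (Wu i) al = nu (al + delta_mx 0 i + delta_mx 0 i)
    - 4 * nu (al + delta_mx 0 i) + 6 * nu al - 4 * nu (al - delta_mx 0 i)
    + nu (al - delta_mx 0 i - delta_mx 0 i).
  rewrite /diff2 /Wu /inner_part Dal Bal alA /diff2 addrK subrK; ring.
have eqD : node a b J al + h i *: delta_mx 0 i *+ 2 =
    node a b J (al + delta_mx 0 i + delta_mx 0 i).
  by rewrite !nodeDe mulr2n addrA.
have eqB : node a b J al - h i *: delta_mx 0 i *+ 2 =
    node a b J (al - delta_mx 0 i - delta_mx 0 i).
  by rewrite !nodeBe mulr2n opprD addrA.
rewrite eqD eqB in d4.
by apply: d4; apply: (grid_closed_box ab J3); [exact: gridD|exact: gridB].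
Qed.

(** The derivatives of [u] pair with their difference quotients into consistency errors of order
    [h_i^2]. The moment is of order [h_i^(p+2)] away from the layer, but only of order [h_i^p] on
    it. *)
Lemma truncation_error_bound al : 0 <= eps -> 0 <= sigma -> 0 <= gamma ->
  al \in A ->
  `|truncation_error i al| <= (eps + sigma + gamma + `|beta 0 i|) * K *
    (h i ^+ 2 + h i `^ p * (h i ^+ 2 + (near_boundary a b J i al)%:R)).
Proof.
move=> eps0 sigma0 gamma0 alA; have hi0 := h_gt0 i.
have [d1 d2 d2' d4] := nu_differences alA.
have Wu_le x : `|Wu i x| <= K * h i ^+ 2.
  rewrite /Wu /inner_part; case: ifPn => [/nu_differences[]//|_].
  by rewrite normr0 mulr_ge0 ?sqr_ge0.
set chi := near_boundary _ _ _ _ _.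
(* On the layer the three values of [Wu] are bounded separately by [K * h i ^+ 2], and the
   coefficients 1, 2, 1 give the 4. *)
have {}d4 : `|diff2 i (Wu i) al| <= 4 * h i ^+ 2 * (K * (h i ^+ 2 + chi%:R)).
  have h2 : 0 <= K * h i ^+ 2 by rewrite mulr_ge0 ?sqr_ge0.
  have h4 : 0 <= K * h i ^+ 4 by rewrite mulr_ge0// exprn_ge0// ltW.
  have [nb|nb] := boolP chi; last first.
    apply: (le_trans (d4 nb)); rewrite addr0.
    by move: h4; rewrite (_ : 4 * _ * _ = 4 * (K * h i ^+ 4)); [lra|ring].
  have := Wu_le al; have := Wu_le (al + delta_mx 0 i).
  have := Wu_le (al - delta_mx 0 i); rewrite /diff2.
  rewrite (_ : 4 * _ * _ = 4 * (K * h i ^+ 4) + 4 * (K * h i ^+ 2)) /=; last by ring.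
  move: (Wu _ _) (Wu _ _) (Wu _ _) (K * _) (K * _) h2 h4 => x y z B4 B2 h2 h4.
  rewrite !ler_norml => /andP[? ?] /andP[? ?] /andP[? ?]; apply/andP; split; lra.
have hiN : h i != 0 by rewrite gt_eqF.
set hp := h i `^ p; have hp0 : 0 <= hp by exact: powR_ge0.
have -> : truncation_error i al = sigma * diff2 i nu al
    + eps / h i ^+ 2 *
      (diff2 i nu al - h i ^+ 2 * partial i (partial i u) (node a b J al))
    - beta 0 i / (2 * h i) * (nu (al + delta_mx 0 i) - nu (al - delta_mx 0 i)
        - 2 * h i * partial i u (node a b J al))
    - gamma * hp / (4 * h i ^+ 2) * diff2 i (Wu i) al.
  rewrite /truncation_error -/hp.
  move: (partial i u _) (partial i (partial i u) _) => D1 D2.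
  move: (diff2 i nu al) (diff2 i (Wu i) al) => D W.
  by field.
have b1 : `|sigma * diff2 i nu al| <= sigma * (K * h i ^+ 2).
  by rewrite normrM (ger0_norm sigma0) ler_wpM2l.
have b2 : `|eps / h i ^+ 2 *
      (diff2 i nu al - h i ^+ 2 * partial i (partial i u) (node a b J al))|
    <= eps * (K * h i ^+ 2).
  have k0 : 0 <= eps / h i ^+ 2 by rewrite divr_ge0 ?sqr_ge0.
  rewrite normrM (ger0_norm k0).
  have -> : eps * (K * h i ^+ 2) = eps / h i ^+ 2 * (K * h i ^+ 4) by field.
  by rewrite ler_wpM2l.
have b3 : `|beta 0 i / (2 * h i) * (nu (al + delta_mx 0 i) -
      nu (al - delta_mx 0 i) - 2 * h i * partial i u (node a b J al))|
    <= `|beta 0 i| * (K * h i ^+ 2).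
  rewrite normrM normf_div; have -> : `|2 * h i| = 2 * h i.
    by rewrite ger0_norm// mulr_ge0// ltW.
  apply: (@le_trans _ _ (`|beta 0 i| / (2 * h i) * (K * h i ^+ 3))).
    by rewrite ler_wpM2l// divr_ge0// mulr_ge0// ltW.
  have -> : `|beta 0 i| / (2 * h i) * (K * h i ^+ 3) =
    (`|beta 0 i| * (K * h i ^+ 2)) / 2 by field.
  have : 0 <= `|beta 0 i| * (K * h i ^+ 2) by rewrite mulr_ge0// mulr_ge0 ?sqr_ge0.
  by lra.
have b4 : `|gamma * hp / (4 * h i ^+ 2) * diff2 i (Wu i) al|
    <= gamma * hp * (K * (h i ^+ 2 + chi%:R)).
  have k0 : 0 <= gamma * hp / (4 * h i ^+ 2).
    by rewrite divr_ge0 ?(mulr_ge0 gamma0 hp0)// mulr_ge0 ?sqr_ge0.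
  rewrite normrM (ger0_norm k0); apply: (le_trans (ler_wpM2l k0 d4)).
  by rewrite [leLHS]mulrA divfK// mulf_neq0 ?expf_neq0.
have x0 : 0 <= K * h i ^+ 2 by rewrite mulr_ge0 ?sqr_ge0.
have y0 : 0 <= hp * (K * (h i ^+ 2 + chi%:R)).
  by rewrite mulr_ge0// mulr_ge0// addr_ge0 ?sqr_ge0.
apply: (le_trans (ler_normB _ _)).
apply: (le_trans (lerD (le_trans (ler_normB _ _)
  (lerD (le_trans (ler_normD _ _) (lerD b1 b2)) b3)) b4)).
rewrite -subr_ge0.
set S := eps + sigma + gamma + _.
have -> : S * K * (h i ^+ 2 + hp * (h i ^+ 2 + chi%:R)) -
    (sigma * (K * h i ^+ 2) + eps * (K * h i ^+ 2) + `|beta 0 i| * (K * h i ^+ 2)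
     + gamma * hp * (K * (h i ^+ 2 + chi%:R))) =
    gamma * (K * h i ^+ 2)
    + (eps + sigma + `|beta 0 i|) * (hp * (K * (h i ^+ 2 + chi%:R))).
  by rewrite /S; ring.
by rewrite addr_ge0// mulr_ge0// !addr_ge0.
Qed.
End Truncation.

End SchemeError.

(** If [eps > 0], the Poincare inequality in the single direction [i0] suffices: its constant
    [4 (J - 1)^2] grows with the mesh, but [(J - 1) h = b - a] turns it into the weight [eps / h^2]
    with [kappa] independent of [J]. Otherwise [kappa] is the infimum of [c], and the nonnegative
    difference terms are dropped. *)
Lemma scheme_coercive (R : realType) (d : nat) (a b : 'rV[R]_d)
    (c : 'rV[R]_d -> R) (eps sigma : R) :
  (0 < d)%N -> (forall i, a 0 i < b 0 i) ->
  (forall x, box a b x -> 0 <= c x) -> 0 <= eps -> 0 <= sigma ->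
  0 < eps \/ 0 < inf [set c x | x in box a b] ->
  exists2 kappa : R, 0 < kappa & forall (J : 'I_d -> nat) (E : 'rV[int]_d -> R),
    (forall i, (3 <= J i)%N) -> off_zero (inner_nodes a b J) E ->
    kappa * \sum_(al <- inner_nodes a b J) E al ^+ 2 <=
      \sum_i (sigma + eps / mesh_step a b J i ^+ 2) *
        - \sum_(al <- inner_nodes a b J) diff2 i E al * E al
      + \sum_(al <- inner_nodes a b J) c (node a b J al) * E al ^+ 2.
Proof.
move=> d_gt0 ab c0 eps0 sigma0 eps_or_c.
have p0 J i : 0 <= sigma + eps / mesh_step a b J i ^+ 2.
  by rewrite addr_ge0// divr_ge0// sqr_ge0.
have P0 J E i : off_zero (inner_nodes a b J) E ->
    0 <= - \sum_(al <- inner_nodes a b J) diff2 i E al * E al.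
  by move=> E0; rewrite oppr_ge0 (sum_diff2_le0 (inner_nodes_uniq _ _ _)).
have inbox J al : al \in inner_nodes a b J -> box a b (node a b J al).
  by move=> /mem_inner_nodes[].
have [eps_gt0|c_gt0] := eps_or_c.
- pose i0 := Ordinal d_gt0.
  have l0 : 0 < b 0 i0 - a 0 i0 by rewrite subr_gt0.
  exists (eps / (4 * (b 0 i0 - a 0 i0) ^+ 2)) => [|J E J3 E0].
    by rewrite divr_gt0// mulr_gt0// exprn_gt0.
  have h0 := mesh_step_gt0 ab J3 i0; set A := inner_nodes a b J.
  have cE : 0 <= \sum_(al <- A) c (node a b J al) * E al ^+ 2.
    rewrite big_seq; apply: sumr_ge0 => al /inbox bal.
    by rewrite mulr_ge0 ?c0 ?sqr_ge0.
  have poincare := @discrete_poincare R _ A (inner_nodes_uniq _ _ _)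
    (delta_mx 0 i0) E (fun al => (al 0 i0)%:~R - 1) ((J i0)%:R - 1) E0.
  have w1 (x : 'rV[int]_d) : ((x + delta_mx 0 i0) 0 i0)%:~R - 1 =
      (x 0 i0)%:~R - 1 + 1 :> R.
    by rewrite !mxE !eqxx rmorphD addrAC.
  have w_le (x : 'rV[int]_d) : (x \in A) || (x + delta_mx 0 i0 \in A) ->
      `|(x 0 i0)%:~R - 1| <= (J i0)%:R - 1 :> R.
    move=> xA; have {xA}x1 : 1 <= x 0 i0 <= (J i0)%:Z - 1.
      case/orP: xA => /mem_inner_nodes/(inner_gridP ab J3)/(_ i0).
        by lia.
      by rewrite !mxE !eqxx /=; lia.
    have -> : (J i0)%:R - 1 = ((J i0)%:Z - 1)%:~R :> R by rewrite rmorphB.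
    have -> : (x 0 i0)%:~R - 1 = (x 0 i0 - 1)%:~R :> R by rewrite rmorphB.
    by rewrite -intr_norm ler_int; lia.
  have {w1 w_le}poincare := poincare w1 w_le.
  rewrite (bigD1 i0)//= -addrA.
  have rest : 0 <= \sum_(i < d | i != i0) (sigma + eps / mesh_step a b J i ^+ 2) *
      - (\sum_(al <- A) diff2 i E al * E al)
      + \sum_(al <- A) c (node a b J al) * E al ^+ 2.
    by rewrite addr_ge0// sumr_ge0// => i _; rewrite mulr_ge0// P0.
  have sP : 0 <= sigma * - \sum_(al <- A) diff2 i0 E al * E al.
    by rewrite mulr_ge0// P0.
  have k0 : 0 <= eps / (4 * (b 0 i0 - a 0 i0) ^+ 2).
    by rewrite divr_ge0// mulr_ge0 ?sqr_ge0.
  have J1 : (J i0)%:R - 1 != 0 :> R.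
    by rewrite gt_eqF// subr_gt0 ltr1n (leq_trans _ (J3 i0)).
  have k1 : eps / (4 * (b 0 i0 - a 0 i0) ^+ 2) * (4 * ((J i0)%:R - 1) ^+ 2) =
      eps / mesh_step a b J i0 ^+ 2.
    by rewrite -(mesh_stepE a b J3); field; rewrite J1 gt_eqF.
  have {poincare} := ler_wpM2l k0 poincare.
  rewrite [_ * (_ * - _)]mulrA k1 -/(diff2 i0 E) => poincare.
  apply: (le_trans poincare).
  rewrite [(sigma + _) * _]mulrDl -addrA addrCA lerDl addr_ge0//.
exists (inf [set c x | x in box a b]) => // J E J3 E0.
rewrite mulr_sumr -[leLHS]add0r lerD//.
  by apply: sumr_ge0 => i _; rewrite mulr_ge0// P0.
rewrite big_seq [leRHS]big_seq; apply: ler_sum => al /inbox bal.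
rewrite ler_wpM2r ?sqr_ge0// ge_inf//; last by exists (node a b J al).
by exists 0 => _ [x xb <-]; exact: c0.
Qed.

(** * Powers of the mesh size and the mesh-weighted truncation error *)

(** The excess exponent [2 - (p + 1/2) = 3/2 - p] lies between 0 and 2 because [0 <= p <= 1], so the
    excess power is at most [L ^+ 2]. *)
Lemma sqr_le_powR (R : realType) (p x H L : R) : 0 <= p <= 1 -> 1 <= L ->
  0 < x -> x <= H -> H <= L -> x ^+ 2 <= L ^+ 2 * H `^ (p + 1 / 2).
Proof.
move=> /andP[p0 p1] L1 x0 xH HL; have H0 : 0 < H := lt_le_trans x0 xH.
have L0 : 0 < L := lt_le_trans ltr01 L1.
apply: (@le_trans _ _ (H ^+ 2)).
  by rewrite lerXn2r// nnegrE ltW.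
have -> : H ^+ 2 = H `^ (3 / 2 - p) * H `^ (p + 1 / 2).
  rewrite -powRD; last by rewrite (gt_eqF H0) /= implybT.
  by rewrite -powR_mulrn ?ltW//; congr (_ `^ _); lra.
rewrite ler_wpM2r ?powR_ge0// -powR_mulrn ?(ltW L0)//.
apply: (@le_trans _ _ (L `^ (3 / 2 - p))).
  by rewrite ge0_ler_powR ?nnegrE ?(ltW H0) ?(ltW L0)//; lra.
by rewrite ler_powR//; lra.
Qed.

(** A squared layer error [h^(2p)] times the layer thickness [h] is the square of the target
    rate. *)
Lemma powR_sqr_mul_le (R : realType) (p x H : R) : 0 <= p -> 0 < x -> x <= H ->
  (x `^ p) ^+ 2 * x <= (H `^ (p + 1 / 2)) ^+ 2.
Proof.
move=> p0 x0 xH; have H0 : 0 < H := lt_le_trans x0 xH.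
have -> : (H `^ (p + 1 / 2)) ^+ 2 = (H `^ p) ^+ 2 * H.
  rewrite powRD; last by rewrite (gt_eqF H0) /= implybT.
  by rewrite exprMn div1r powR12_sqrt ?ltW// sqr_sqrtr ?ltW.
have xpH : x `^ p <= H `^ p by rewrite ge0_ler_powR ?nnegrE ?(ltW x0) ?(ltW H0).
by rewrite ler_pM ?sqr_ge0 ?(ltW x0)// lerXn2r ?nnegrE ?powR_ge0.
Qed.

Lemma powR_le_max (R : realType) (p x L : R) : 0 <= p <= 1 -> 1 <= L ->
  0 <= x -> x <= L -> x `^ p <= L.
Proof.
move=> /andP[p0 p1] L1 x0 xL.
apply: (@le_trans _ _ (L `^ p)).
  by rewrite ge0_ler_powR ?nnegrE// (le_trans ler01).
by rewrite -[leRHS]powRr1 ?ler_powR// (le_trans ler01).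
Qed.

(** The part of the error of order [theta] is summed over the whole box, giving the first constant;
    the layer part, of order only [h_i^p], is summed over a set of volume [O(h_i)], giving the
    second. *)
Lemma mesh_volume_truncation (R : realType) (d : nat) (a b beta : 'rV[R]_d)
    (J : 'I_d -> nat) (u : 'rV[R]_d -> R) (eps sigma gamma p M L : R) i :
  (forall i, a 0 i < b 0 i) -> (forall i, (3 <= J i)%N) -> 0 <= p <= 1 ->
  1 <= L -> mesh_size a b J <= L ->
  0 <= M ->
  (forall al, al \in inner_nodes a b J ->
    `|truncation_error a b beta J u eps sigma gamma p i al| <=
      M * (mesh_step a b J i ^+ 2 + mesh_step a b J i `^ p *
        (mesh_step a b J i ^+ 2 + (near_boundary a b J i al)%:R))) ->
  (\prod_j mesh_step a b J j) * \sum_(al <- inner_nodes a b J)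
    truncation_error a b beta J u eps sigma gamma p i al ^+ 2 <=
  (8 * M ^+ 2 * L ^+ 6 * \prod_j (b 0 j - a 0 j)
   + 4 * M ^+ 2 * \prod_(j | j != i) (b 0 j - a 0 j)) *
  (mesh_size a b J `^ (p + 1 / 2)) ^+ 2.
Proof.
move=> ab J3 p01 L1 HL M0 tauM.
have P0 : 0 <= \prod_j mesh_step a b J j.
  by apply: prodr_ge0 => j _; exact/ltW/mesh_step_gt0.
have V0 : 0 <= \prod_(j | j != i) (b 0 j - a 0 j).
  by apply: prodr_ge0 => j _; rewrite subr_ge0 ltW.
have x0 := mesh_step_gt0 ab J3 i; have xH := mesh_step_le_size a b J i.
have x2 := sqr_le_powR p01 L1 x0 xH HL.
have q2 := powR_sqr_mul_le (proj1 (andP p01)) x0 xH.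
have qL := powR_le_max p01 L1 (ltW x0) (le_trans xH HL).
have inner := mesh_volume_inner ab J3.
have layer := mesh_volume_near_boundary ab J3 i.
set x := mesh_step a b J i in x0 xH x2 q2 qL layer tauM.
set theta := _ `^ (p + 1 / 2) in x2 q2 *.
set q := x `^ p in q2 qL tauM; have q0 : 0 <= q by exact: powR_ge0.
have theta0 : 0 <= theta by exact: powR_ge0.
have L0 : 0 <= L := le_trans ler01 L1.
(* This is [(s + t)^2 <= 2 s^2 + 2 t^2] with [s = 2 M L^3 theta] and [t = M q chi], where [chi] is 0
   or 1 and so equals its square. The 2 in [s] counts the terms [x ^+ 2] and [q * x ^+ 2], each at
   most [L^3 theta]. *)
have tau2 al : al \in inner_nodes a b J ->
    truncation_error a b beta J u eps sigma gamma p i al ^+ 2 <=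
    8 * M ^+ 2 * L ^+ 6 * theta ^+ 2
    + 2 * M ^+ 2 * q ^+ 2 * (near_boundary a b J i al : nat)%:R.
  move=> /tauM; set tau := truncation_error _ _ _ _ _ _ _ _ _ _ _.
  set chi := near_boundary _ _ _ _ _ => tau_le.
  have bound : `|tau| <= 2 * M * L ^+ 3 * theta + M * q * chi%:R.
    have x2L : x ^+ 2 <= L ^+ 3 * theta.
      apply: (le_trans x2); rewrite ler_wpM2r// -[leLHS]mul1r [L ^+ 3]exprS.
      by rewrite ler_wpM2r ?exprn_ge0.
    have qx2 : q * x ^+ 2 <= L ^+ 3 * theta.
      by rewrite [L ^+ 3]exprS -mulrA ler_pM ?sqr_ge0.
    apply: (le_trans tau_le).
    have -> : 2 * M * L ^+ 3 * theta + M * q * chi%:R =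
      M * (2 * (L ^+ 3 * theta) + q * chi%:R) by ring.
    by rewrite ler_wpM2l// mulrDr; lra.
  rewrite -[leLHS]real_normK ?num_real//.
  apply: (@le_trans _ _ ((2 * M * L ^+ 3 * theta + M * q * chi%:R) ^+ 2)).
    by rewrite lerXn2r// nnegrE// (le_trans _ bound).
  have chi2 : chi%:R ^+ 2 = chi%:R :> R
    by case: (chi) => /=; rewrite ?expr1n ?expr0n.
  move: chi2; set y := chi%:R => y2; rewrite -subr_ge0.
  have -> : 8 * M ^+ 2 * L ^+ 6 * theta ^+ 2 + 2 * M ^+ 2 * q ^+ 2 * y
      - (2 * M * L ^+ 3 * theta + M * q * y) ^+ 2 =
    (2 * M * L ^+ 3 * theta - M * q * y) ^+ 2
      + 2 * M ^+ 2 * q ^+ 2 * (y - y ^+ 2) by ring.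
  by rewrite y2 subrr mulr0 addr0 sqr_ge0.
apply: (@le_trans _ _ ((\prod_j mesh_step a b J j) *
  \sum_(al <- inner_nodes a b J) (8 * M ^+ 2 * L ^+ 6 * theta ^+ 2
    + 2 * M ^+ 2 * q ^+ 2 * (near_boundary a b J i al : nat)%:R))).
  by rewrite ler_wpM2l// big_seq [leRHS]big_seq; exact: ler_sum.
rewrite [\sum_(al <- _) (_ + _)]big_split /= -[X in _ * (_ + X) <= _]mulr_sumr.
have -> : \sum_(al <- inner_nodes a b J) (near_boundary a b J i al : nat)%:R =
    (count (near_boundary a b J i) (inner_nodes a b J))%:R :> R.
  by rewrite -natr_sum -sum1_count [in RHS]big_mkcond; congr _%:R.
rewrite big_const_seq count_predT iter_addr_0 -[_ *+ size _]mulr_natr.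
move: inner layer P0 V0; set P := \prod_j mesh_step _ _ _ _.
set Ni := (size _)%:R; set Nl := (count _ _)%:R; set V := \prod_j (b 0 j - _).
set Vi := \prod_(_ < _ | _) _ => inner layer P0 Vi0.
have -> : P * (8 * M ^+ 2 * L ^+ 6 * theta ^+ 2 * Ni + 2 * M ^+ 2 * q ^+ 2 * Nl) =
  8 * M ^+ 2 * L ^+ 6 * theta ^+ 2 * (P * Ni) + 2 * M ^+ 2 * q ^+ 2 * (P * Nl).
  by ring.
have -> : (8 * M ^+ 2 * L ^+ 6 * V + 4 * M ^+ 2 * Vi) * theta ^+ 2 =
  8 * M ^+ 2 * L ^+ 6 * theta ^+ 2 * V + 4 * M ^+ 2 * Vi * theta ^+ 2 by ring.
apply: lerD; first by rewrite ler_wpM2l// !mulr_ge0 ?exprn_ge0.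
apply: (@le_trans _ _ (2 * M ^+ 2 * q ^+ 2 * (2 * x * Vi))).
  by rewrite ler_wpM2l// !mulr_ge0 ?exprn_ge0.
have -> : 2 * M ^+ 2 * q ^+ 2 * (2 * x * Vi) = 4 * M ^+ 2 * Vi * (q ^+ 2 * x).
  by ring.
by rewrite ler_wpM2l// !mulr_ge0 ?exprn_ge0.
Qed.

Lemma prod_powR_half (R : realType) (d : nat) (x : 'I_d -> R) :
  (forall i, 0 <= x i) -> \prod_i x i `^ (1 / 2) = Num.sqrt (\prod_i x i).
Proof.
move=> x0; rewrite div1r; under eq_bigr do rewrite powR12_sqrt//.
suff [] : \prod_i Num.sqrt (x i) = Num.sqrt (\prod_i x i) /\ 0 <= \prod_i x i by [].
elim/big_ind2 : _ => [|y1 y2 z1 z2 [-> y0] [-> z0]|i _]; rewrite ?sqrtr1//.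
by rewrite sqrtrM// mulr_ge0.
Qed.

(** * Assembly of the error estimate *)

Theorem theorem6p4 (R : realType) (d : nat) (a b beta : 'rV[R]_d)
    (c f g u : 'rV[R]_d -> R) (eps sigma gamma p : R)
    (d_gt0 : (0 < d)%N)
    (ab : forall i : 'I_d, a 0 i < b 0 i)
    (c_bounded : [bounded c x | x in box a b])
    (c_ge0 : forall x, box a b x -> 0 <= c x)
    (f_bounded : [bounded f x | x in box a b])
    (g_continuous : {within frontier (box a b), continuous g})
    (eps_ge0 : 0 <= eps) (sigma_ge0 : 0 <= sigma) (gamma_ge0 : 0 <= gamma)
    (p01 : 0 <= p <= 1)
    (eps_or_c0 : 0 < eps \/ 0 < inf [set c x | x in box a b])
    (u_C5 : Ck_closure 5 (box a b) u)
    (u_sol : bvp_solution (box a b) eps beta c f g u) :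
  exists C : R, forall (J : 'I_d -> nat) (U : 'rV[int]_d -> R),
    (forall i, (3 <= J i)%N) ->
    scheme_solution a b J eps sigma gamma p beta c f g U ->
    (\prod_(i < d) mesh_step a b J i `^ (1 / 2)) *
      l2_norm (inner_grid a b J) (fun al => U al - u (node a b J al))
    <= C * mesh_size a b J `^ (p + 1 / 2).
Proof.
have [K K0 u_differences] := finite_differences ab u_C5.
have [kappa kappa0 coercive] :=
  scheme_coercive d_gt0 ab c_ge0 eps_ge0 sigma_ge0 eps_or_c0.
(* [L] dominates each side length, hence every mesh size; the added 1 ensures [1 <= L]. *)
pose L := \sum_i (b 0 i - a 0 i) + 1.
have ba0 i : 0 <= b 0 i - a 0 i by rewrite subr_ge0 ltW.
have L1 : 1 <= L by rewrite lerDr sumr_ge0.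
pose M i := (eps + sigma + gamma + `|beta 0 i|) * K.
have M0 i : 0 <= M i by rewrite mulr_ge0// !addr_ge0.
(* [G i] is the constant of [mesh_volume_truncation] in direction [i], free of [J]. The final
   constant is a square root because the energy estimate bounds the squared norm. *)
pose G i := 8 * M i ^+ 2 * L ^+ 6 * \prod_j (b 0 j - a 0 j)
   + 4 * M i ^+ 2 * \prod_(j | j != i) (b 0 j - a 0 j).
exists (Num.sqrt (d%:R / kappa ^+ 2 * \sum_i G i)) => J U J3 U_sol.
have h_gt0 i := mesh_step_gt0 ab J3 i.
have HL : mesh_size a b J <= L.
  apply/bigmax_leP; split=> [|i _]; first exact: le_trans L1.
  rewrite /L (bigD1 i)//= -addrA.
  apply: (@le_trans _ _ (b 0 i - a 0 i)).
    rewrite -(mesh_stepE a b J3) ler_peMl ?ltW//.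
    have : 3 <= (J i)%:R :> R by rewrite ler_nat.
    lra.
  by rewrite lerDl addr_ge0// sumr_ge0.
set A := inner_nodes a b J.
set E := inner_part a b J (fun al => U al - u (node a b J al)).
have E0 : off_zero A E by exact: inner_part_off.
have estimate := energy_estimate (inner_nodes_uniq a b J) d_gt0 E0
  (fun i => inner_part_off (diff2 i E)) _ _ kappa0 (coercive J E J3 E0)
  (error_equation ab J3 u_sol U_sol).
have {}estimate : \sum_(al <- A) E al ^+ 2 <= d%:R / kappa ^+ 2 *
  \sum_i \sum_(al <- A) truncation_error a b beta J u eps sigma gamma p i al ^+ 2.
  apply: estimate => [i al alA|i]; first by rewrite /inner_part alA.
  by rewrite divr_ge0 ?(mulr_ge0 gamma_ge0 (powR_ge0 _ _))// mulr_ge0 ?sqr_ge0.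
have P0 : 0 <= \prod_i mesh_step a b J i by apply: prodr_ge0 => i _; exact: ltW.
set theta := mesh_size a b J `^ (p + 1 / 2).
have theta0 : 0 <= theta by exact: powR_ge0.
have bound : (\prod_i mesh_step a b J i) * \sum_(al <- A) E al ^+ 2 <=
    d%:R / kappa ^+ 2 * (\sum_i G i) * theta ^+ 2.
  apply: (le_trans (ler_wpM2l P0 estimate)).
  rewrite mulrCA -(mulrA (d%:R / kappa ^+ 2)) ler_wpM2l ?divr_ge0 ?sqr_ge0//.
  rewrite mulr_sumr mulr_suml; apply: ler_sum => i _.
  apply: mesh_volume_truncation => // al alA.
  by apply: truncation_error_bound => // x s s0 xab; exact: u_differences.
have normE : l2_norm (inner_grid a b J) (fun al => U al - u (node a b J al)) =
    Num.sqrt (\sum_(al <- A) E al ^+ 2).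
  rewrite /l2_norm fsbig_finite; last exact: finite_inner_grid.
  congr Num.sqrt; rewrite big_seq [RHS]big_seq; apply: eq_bigr => al alA.
  by rewrite real_normK ?num_real// /E /inner_part alA.
rewrite normE prod_powR_half => [|i]; last exact: ltW.
(* Writing [theta] as the root of its square puts both sides under one square root, so [bound]
   applies. *)
rewrite -sqrtrM// -[X in _ <= _ * X](ger0_norm theta0) -sqrtr_sqr -sqrtrM.
  exact: ler_wsqrtr.
rewrite mulr_ge0 ?divr_ge0 ?sqr_ge0//; apply: sumr_ge0 => i _.
have M2 : 0 <= M i ^+ 2 by exact: sqr_ge0.
rewrite /G addr_ge0// mulr_ge0 ?prodr_ge0//; last by rewrite mulr_ge0.
have L6 : 0 <= L ^+ 6 by rewrite exprn_ge0// (le_trans ler01).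
by rewrite mulr_ge0// mulr_ge0.
Qed.
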